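(* Consider contextual search with the pricing loss $\ell(y,u)=u-y\cdot\mathbf{1}\{y\le u\}$. Let the learner run the following algorithm (Multiscale Steiner Potential for Pricing): set $S_1=B$ and $z_i=2^{-3\cdot2^{i}}/(16d)$ for all indices $i$; in each round $t$, after the adversary reveals $x_t$: if $\mathrm{width}(S_t;x_t)\le 1/T$, guess $y_t=\min_{v\in S_t}\langle v,x_t\rangle$; otherwise let $i$ be the largest index such that $\mathrm{width}(S_t;x_t)\le 2^{-2^i}$, let $m_t$ be such that $\mathrm{Vol}(\{v\in S_t+z_iB:\langle v,x_t\rangle\le m_t\})=2^{-2^{i-1}}\mathrm{Vol}(S_t+z_iB)$, and guess $y_t=m_t-z_i$. Then the total loss $\sum_{t=1}^T\ell(y_t,\langle v_0,x_t\rangle)$ is $O(d\log\log T+d\log d)$.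
   Context: Contextual search setting: $d\ge1$, $T\ge1$, and $B=\{v\in\mathbb{R}^d:\|v\|_2\le1\}$. A hidden vector $v_0\in B$ is fixed. In each round $t=1,\dots,T$ an adversary chooses $x_t\in B$, the learner chooses a guess $y_t\in\mathbb{R}$, incurs loss $\ell(y_t,\langle v_0,x_t\rangle)$, and receives feedback $\sigma_t\in\{-1,+1\}$, where $\sigma_t=+1$ if $y_t>\langle v_0,x_t\rangle$, $\sigma_t=-1$ if $y_t<\langle v_0,x_t\rangle$, and $\sigma_t$ is arbitrary if equal. The knowledge set is $S_t=\{v\in B:\ \sigma_\tau(y_\tau-\langle v,x_\tau\rangle)\ge0\text{ for all }\tau<t\}$. $\mathrm{width}(S;x)=\max_{v\in S}\langle v,x\rangle-\min_{v\in S}\langle v,x\rangle$; $S+zB$ is the Minkowski sum $\{w+zu:w\in S,u\in B\}$; $\mathrm{Vol}$ is Lebesgue measure on $\mathbb{R}^d$.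
   Formalization: Indices i are the natural numbers; when width(S_t;x_t) > 1/2, so that no index i satisfies width ≤ 2^{-2^i} (e.g. round 1 with a unit x_1, width 2), the algorithm uses i = 0. The bound is stated for T ≥ 3, where log log T > 0. *)

(* Defs.v *)
From HB Require Import structures.
From mathcomp Require Import all_boot all_order all_algebra.
From mathcomp Require Import all_classical all_reals all_analysis.

Set Implicit Arguments.
Unset Strict Implicit.
Unset Printing Implicit Defensive.

Import Order.TTheory GRing.Theory Num.Theory.
Import numFieldNormedType.Exports.

Local Open Scope classical_set_scope.
Local Open Scope ring_scope.

Definition cons_measure (R : realType) (n : nat)
    (mu : set (n.-tuple (measurableTypeR R)) -> \bar R) :
    set (n.+1.-tuple (measurableTypeR R)) -> \bar R :=
  pushforward (product_measure1 (@lebesgue_measure R) mu)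
    (fun p => cons_tuple p.1 p.2).

Section cons_measure_sigma_finite.
Variables (R : realType) (n : nat).
Variable mu : {sigma_finite_measure set (n.-tuple (measurableTypeR R)) -> \bar R}.

Let pcons (p : measurableTypeR R * n.-tuple (measurableTypeR R)) :
    n.+1.-tuple (measurableTypeR R) := cons_tuple p.1 p.2.

Let mpcons : measurable_fun setT pcons.
Proof. exact: (measurable_cons measurable_fst measurable_snd). Qed.

Let pmu : {measure
    set (measurableTypeR R * n.-tuple (measurableTypeR R))%type -> \bar R} :=
  product_measure1 (@lebesgue_measure R) mu.

(* The canonical instance on a pushforward depends on the measurability of the
   map, so it has to be given explicitly. *)
Let cmu : {measure set (n.+1.-tuple (measurableTypeR R)) -> \bar R} :=
  measure_function_pushforward__canonical__measure_function_Measure pmu mpcons.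

HB.instance Definition _ := isMeasure.Build _ _ _ (cons_measure mu)
  (measure0 cmu) (measure_ge0 cmu) (@measure_semi_sigma_additive _ _ _ cmu).

(* The library's sigma-finite instance on product_measure1 is only inferred for
   subprobabilities, so sigma-finiteness is proved directly. *)
Let cons_measure_sigma_finite : sigma_finite setT (cons_measure mu).
Proof.
have /sigma_finiteP[F [TF ndF Foo]] := sigma_finiteT (@lebesgue_measure R).
have /sigma_finiteP[G [TG ndG Goo]] := sigma_finiteT mu.
pose uncons (t : n.+1.-tuple (measurableTypeR R)) :
  (measurableTypeR R * n.-tuple (measurableTypeR R))%type :=
  ((thead t : R), [tuple of behead t]).
have muncons : measurable_fun setT uncons.
  by apply: measurable_fun_pair; [exact: measurable_tnth|exact: measurable_behead].
exists (fun k => uncons @^-1` (F k `*` G k)).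
  apply/seteqP; split=> // t _.
  have [i _ Fi] : (\bigcup_k F k) (thead t) by rewrite -TF.
  have [j _ Gj] : (\bigcup_k G k) [tuple of behead t] by rewrite -TG.
  exists (maxn i j) => //; split.
    by move: Fi; exact/subsetPset/ndF/leq_maxl.
  by move: Gj; exact/subsetPset/ndG/leq_maxr.
move=> k; have [mF Fk] := Foo k; have [mG Gk] := Goo k; split.
  by rewrite -[X in measurable X]setTI; apply: muncons => //; exact: measurableX.
rewrite /cons_measure /pushforward -comp_preimage.
rewrite (_ : uncons \o _ = id); last first.
  by apply/funext => -[u t]; congr pair => //; exact/val_inj.
by rewrite preimage_id product_measure1E// lte_mul_pinfty// ge0_fin_numE.
Qed.

HB.instance Definition _ := Measure_isSigmaFinite.Build _ _ _ (cons_measure mu)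
  cons_measure_sigma_finite.

End cons_measure_sigma_finite.

(* Lebesgue measure on the product sigma-algebra of n.-tuple R, as the n-fold
   product of the one-dimensional Lebesgue measure. *)
Fixpoint lebesgue_tuple (R : realType) (n : nat) :
    {sigma_finite_measure set (n.-tuple (measurableTypeR R)) -> \bar R} :=
  match n with
  | 0 => \d_([tuple] : 0.-tuple (measurableTypeR R))
  | n'.+1 => cons_measure (@lebesgue_tuple R n')
  end.

Lemma lebesgue_tuple_box (R : realType) (n : nat) (a b : 'I_n -> R) :
  (forall i, a i <= b i) ->
  lebesgue_tuple R n [set t | forall i, a i <= tnth t i <= b i] =
  (\prod_(i < n) (b i - a i))%:E.
Proof.
elim: n a b => [|n IH] a b ab.
  by rewrite big_ord0 /= diracE mem_set// => -[].
have -> : lebesgue_tuple R n.+1 [set t | forall i, a i <= tnth t i <= b i] =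
   product_measure1 (@lebesgue_measure R) (lebesgue_tuple R n)
   (`[a ord0, b ord0] `*` [set t | forall i, a (lift ord0 i) <= tnth t i <= b (lift ord0 i)]).
  rewrite /= /cons_measure /pushforward; congr product_measure1.
  apply/seteqP; split=> -[u t] /=.
    move=> h; split; first by rewrite in_itv; exact: (h ord0).
    by move=> i; have := h (lift ord0 i); rewrite tnthS.
  move=> [+ h] i; rewrite in_itv /= => h0.
  case: (unliftP ord0 i) => [j|] ->; last exact: h0.
  by rewrite tnthS.
rewrite product_measure1E//; first last.
  rewrite (_ : mkset _ = \bigcap_(i in [set: 'I_n])
    ((fun t : n.-tuple (measurableTypeR R) => tnth t i) @^-1` `[a (lift ord0 i), b (lift ord0 i)])).
    apply: fin_bigcap_measurable => // i _.
    by rewrite -[X in measurable X]setTI; exact: measurable_tnth.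
  apply/seteqP; split=> t /= h i; first by move=> _; rewrite /= in_itv; exact: h.
  by have := h i I; rewrite /= in_itv.
rewrite IH//= lebesgue_measure_itv /= big_ord_recl EFinM.
congr *%E; case: ltP => // ba; rewrite lee_fin in ba.
by rewrite (_ : b ord0 = a ord0) ?subrr//; apply/le_anti; rewrite ba ab.
Qed.

Definition vol (R : realType) (d : nat) (A : set 'rV[R]_d) : \bar R :=
  lebesgue_tuple R d [set t | A (\row_i tnth t i)].

Definition dotv (R : realType) (d : nat) (u v : 'rV[R]_d) : R :=
  \sum_(i < d) u ord0 i * v ord0 i.

(* The norm `|v| on 'rV[R]_d is the sup norm, hence the explicit Euclidean
   norm. *)
Definition unit_ball (R : realType) (d : nat) : set 'rV[R]_d :=
  [set v | Num.sqrt (dotv v v) <= 1].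
Arguments unit_ball R d : clear implicits.

(* For S compact and nonempty, as the knowledge sets below are, sup and inf are
   the maximum and the minimum. *)
Definition max_along (R : realType) (d : nat) (S : set 'rV[R]_d) (x : 'rV[R]_d) : R :=
  sup [set dotv v x | v in S].

Definition min_along (R : realType) (d : nat) (S : set 'rV[R]_d) (x : 'rV[R]_d) : R :=
  inf [set dotv v x | v in S].

Definition width (R : realType) (d : nat) (S : set 'rV[R]_d) (x : 'rV[R]_d) : R :=
  max_along S x - min_along S x.

Definition minkowski_ball (R : realType) (d : nat) (S : set 'rV[R]_d) (z : R) :
    set 'rV[R]_d :=
  [set w + z *: u | w in S & u in unit_ball R d].

Definition feedback (R : realType) (y u sigma : R) : Prop :=
  [/\ sigma = 1 \/ sigma = -1, u < y -> sigma = 1 & y < u -> sigma = -1].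

(* Rounds are numbered from 1, so that the set at t = 1 is the whole ball. *)
Definition knowledge_set (R : realType) (d : nat) (x : nat -> 'rV[R]_d)
    (y sigma : nat -> R) (t : nat) : set 'rV[R]_d :=
  [set v | unit_ball R d v /\
    forall tau : nat, (1 <= tau < t)%N -> 0 <= sigma tau * (y tau - dotv v (x tau))].

Definition pricing_loss (R : realType) (y u : R) : R :=
  u - y * (y <= u)%R%:R.

Definition scale (R : realType) (i : nat) : R := 2 `^ (- 2 ^+ i).

Definition expansion (R : realType) (d i : nat) : R :=
  2 `^ (- (3 * 2 ^+ i)) / (16 * d%:R).

Definition mass_fraction (R : realType) (i : nat) : R :=
  2 `^ (- 2 `^ (i%:R - 1)).

(* The scales are indexed by the natural numbers.  A width w can be as large as
   2, in which case no scale is above w; index 0 is then used.  For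
   w <= scale R 0 this is the largest i such that w <= scale R i. *)
Definition scale_index (R : realType) (w : R) (i : nat) : Prop :=
  (w <= scale R i /\ forall j : nat, w <= scale R j -> (j <= i)%N)
  \/ (scale R 0 < w /\ i = 0%N).

Definition steiner_pricing_guess (R : realType) (d T : nat) (S : set 'rV[R]_d)
    (x : 'rV[R]_d) (y : R) : Prop :=
  (width S x <= T%:R^-1 -> y = min_along S x) /\
  (T%:R^-1 < width S x ->
     exists (i : nat) (m : R),
       [/\ scale_index (width S x) i,
           vol [set v | minkowski_ball S (expansion R d i) v /\ dotv v x <= m] =
             ((mass_fraction R i)%:E * vol (minkowski_ball S (expansion R d i)))%E
         & y = m - expansion R d i]).

(* Main.v *)
(** For a convex body [K] and a point [p] of [K], the homothety of ratio [c <= 1]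
    centred at [p] maps [K] into itself and scales volumes by [c ^+ d].  With [p]
    extremal in direction [x], it shows that a slab of [K] orthogonal to [x] that
    is thin compared with [width K x / d] contains a small part of [K].  Hence for
    [K = S_t + z_i B] both answers to a guess shrink the volume of [K]: a guess
    above the value by a factor [f = mass_fraction i], a guess below it by a factor
    [1 - 5 / 8 * f].  As [f <= 1 / a] for [a = - ln f], in both cases the loss is
    at most [8 / a] times the decrease of [ln (Vol (S_t + z_i B))].  These
    potentials are monotone in [t], and the total decrease of the [i]-th is at most
    [d * (6 a + ln 32 + 2 ln d)] by comparison with cubes; since [a] is
    proportional to [2 ^ i], summing over the [O(log log T)] indices in use gives
    the bound. *)

Require Import Defs.
From mathcomp Require Import all_boot all_order all_algebra.
From mathcomp Require Import all_classical all_reals all_analysis.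
From mathcomp Require Import measurable_realfun.
From mathcomp Require Import ring lra.

Import Order.TTheory GRing.Theory Num.Theory.
Import numFieldNormedType.Exports.
Local Open Scope classical_set_scope.
Local Open Scope ring_scope.

Set Implicit Arguments.
Unset Strict Implicit.

(** * Lebesgue measure of affine images *)

(** By uniqueness of Lebesgue measure: [c] times its pushforward by [x -> p + c * x] gives every
    half-open interval its length. *)
Lemma lebesgue_measure_affine_preimage (R : realType) (p c : R) (A : set R) :
  0 < c -> measurable A ->
  (@lebesgue_measure R [set x | A (p + c * x)%R] = c^-1%:E * @lebesgue_measure R A)%E.
Proof.
move=> c0 mA.
pose f (x : measurableTypeR R) : measurableTypeR R := p + c * x.
have mf : measurable_fun setT f.
  by apply: measurable_funD => //; exact: measurable_funM.
pose mu : {measure set (measurableTypeR R) -> \bar R} :=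
  measure_function_pushforward__canonical__measure_function_Measure
    (@lebesgue_measure R) mf.
have := @lebesgue_measure_unique R (mscale (NngNum (ltW c0)) mu) _ A mA.
rewrite /= /mscale /= => ->; last first.
  move=> _ [[a b] _ <-] /=; rewrite /mscale /= /pushforward.
  rewrite (_ : f @^-1` _ = `](a - p) / c, (b - p) / c]%classic); last first.
    apply/seteqP; split => x /=; rewrite !in_itv/= ler_pdivlMr// ltr_pdivrMr//;
      by rewrite ltrBlDl lerBrDl [x * c]mulrC.
  rewrite !lebesgue_measure_itv /= !lte_fin ltr_pM2r ?invr_gt0// ltrD2r.
  case: ifPn => _; last by rewrite mule0.
  rewrite -EFinB -EFinM; congr EFin; field; exact: lt0r_neq0.
by rewrite muleA -EFinM mulVf ?lt0r_neq0// mul1e.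
Qed.

Section affine.
Variable R : realType.
Local Notation T := (measurableTypeR R).

Definition affine_tuple n (p : n.-tuple T) (c : R) (t : n.-tuple T) : n.-tuple T :=
  [tuple (tnth p i + c * tnth t i : T) | i < n].

Lemma measurable_affine_tuple n (p : n.-tuple T) c :
  measurable_fun setT (affine_tuple p c).
Proof.
apply/measurable_fun_tnthP => i.
rewrite (_ : _ \o _ = fun t : n.-tuple T => tnth p i + c * tnth t i); last first.
  by apply/funext => t /=; rewrite tnth_mktuple.
apply: measurable_funD => //; apply: measurable_funM => //.
exact: measurable_tnth.
Qed.

(** Induction on [n]. Through [pcons] the affine map becomes [psi], which acts separately on head
    and tail. Hence [c ^+ n.+1] times the pushforward by [psi] agrees with the product measure on
    rectangles, and uniqueness of product measures concludes. *)
Lemma lebesgue_tuple_affine_preimage n (p : n.-tuple T) (c : R)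
    (A : set (n.-tuple T)) :
  0 < c -> measurable A ->
  (lebesgue_tuple R n (affine_tuple p c @^-1` A) =
    (c ^- n)%:E * lebesgue_tuple R n A)%E.
Proof.
move=> c0; elim: n p A => [|n IH] p A mA.
  rewrite expr0 invr1 mul1e; congr (lebesgue_tuple R 0 _).
  by apply/seteqP; split=> t /=; rewrite (tuple0 t) (tuple0 (affine_tuple _ _ _)).
pose pcons (q : T * n.-tuple T) : n.+1.-tuple T := cons_tuple q.1 q.2.
have mpcons : measurable_fun setT pcons.
  exact: (measurable_cons measurable_fst measurable_snd).
pose p0 : R := thead p.
pose p' : n.-tuple T := [tuple of behead p].
pose psi (q : T * n.-tuple T) : T * n.-tuple T :=
  ((p0 + c * q.1 : R), affine_tuple p' c q.2).
have mpsi : measurable_fun setT psi.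
  apply: measurable_fun_pair.
    by apply: measurable_funD => //; apply: measurable_funM.
  apply: (measurableT_comp (measurable_affine_tuple p' c)).
  exact: measurable_snd.
pose mu : {measure set (T * n.-tuple T) -> \bar R} :=
  measure_function_pushforward__canonical__measure_function_Measure
   (product_measure1 (@lebesgue_measure R) (lebesgue_tuple R n)) mpsi.
have mB : measurable (pcons @^-1` A).
  by rewrite -[X in measurable X]setTI; exact: mpcons.
have cn0 : 0 <= c ^+ n.+1 by rewrite exprn_ge0 // ltW.
have -> : lebesgue_tuple R n.+1 A =
    product_measure1 (@lebesgue_measure R) (lebesgue_tuple R n) (pcons @^-1` A) by [].
have -> : lebesgue_tuple R n.+1 (affine_tuple p c @^-1` A) =
    product_measure1 (@lebesgue_measure R) (lebesgue_tuple R n)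
      (psi @^-1` (pcons @^-1` A)).
  rewrite /= /cons_measure /pushforward; congr product_measure1.
  apply/funext => -[u t] /=; congr A.
  apply/eq_from_tnth => i; rewrite tnth_mktuple.
  case: (unliftP ord0 i) => [j|] ->; rewrite /pcons /psi /= ?tnthS ?tnth0 //=.
  rewrite tnth_mktuple /p' tnth_behead; congr (tnth p _ + _).
  by apply/val_inj; rewrite /= inordK // ltnS.
have := @product_measure_unique _ _ _ _ R (@lebesgue_measure R) (lebesgue_tuple R n)
  (mscale (NngNum cn0) mu) _ (pcons @^-1` A) mB.
rewrite /= /mscale /= => ->; last first.
  move=> B C mB' mC; rewrite /mscale /= /mu /= /pushforward.
  rewrite (_ : psi @^-1` _ = [set x | B (p0 + c * x)] `*` (affine_tuple p' c @^-1` C)) //.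
  rewrite product_measure1E//; last 2 first.
    rewrite -[X in measurable X]setTI.
    apply: (_ : measurable_fun setT (fun x : T => p0 + c * x : T)) => //.
    by apply: measurable_funD => //; apply: measurable_funM.
    by rewrite -[X in measurable X]setTI; exact: measurable_affine_tuple.
  rewrite IH// [X in (_ * (X * _))%E](_ : _ = (c^-1%:E * @lebesgue_measure R B)%E).
    rewrite muleACA -EFinM [LHS]muleA -EFinM.
    rewrite [X in X%:E](_ : _ = 1) ?mul1e// exprS; field.
    by rewrite expf_neq0 ?lt0r_neq0.
  have := (lebesgue_measure_affine_preimage p0 c0 mB'). apply.
by rewrite muleA -EFinM mulVf ?mul1e // lt0r_neq0 // exprn_gt0.
Qed.
End affine.

(** * Measurability and volume of sets of row vectors *)

Section vol_theory.
Variables (R : realType) (d : nat).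
Local Notation T := (measurableTypeR R).
Implicit Types (A B : set 'rV[R]_d) (p : 'rV[R]_d) (M : R).

(** The sigma-algebra lives on tuples, so this asks for measurability of the very set that [vol]
    measures. *)
Definition row_measurable A :=
  measurable [set t : d.-tuple T | A (\row_i tnth t i)].

Lemma row_measurable_setC A : row_measurable A -> row_measurable (~` A).
Proof. exact: measurableC. Qed.

Lemma row_measurable_setI A B :
  row_measurable A -> row_measurable B -> row_measurable (A `&` B).
Proof. exact: measurableI. Qed.

Lemma row_measurable_setD A B :
  row_measurable A -> row_measurable B -> row_measurable (A `\` B).
Proof. exact: measurableD. Qed.

Lemma row_measurable_coord (D : 'I_d -> set T) :
  (forall i, measurable (D i)) ->
  row_measurable [set v | forall i, D i (v ord0 i)].
Proof.
move=> mD; rewrite /row_measurable.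
rewrite (_ : mkset _ = \bigcap_(i in [set: 'I_d])
    ((fun t : d.-tuple T => tnth t i) @^-1` D i)).
  apply: fin_bigcap_measurable => // i _.
  by rewrite -[X in measurable X]setTI; exact: measurable_tnth.
apply/seteqP; split=> t /= h i.
  by move=> _; have := h i; rewrite mxE.
by rewrite mxE; exact: h.
Qed.

Lemma ball_row_measurable p (e : R) : row_measurable (ball p e).
Proof.
have [e0|e0] := ltP 0 e; last first.
  rewrite (_ : ball p e = set0); first exact: measurable0.
  apply/seteqP; split=> // v; rewrite mx_norm_ball /=.
  by move=> /(le_lt_trans (normr_ge0 _)); rewrite ltNge e0.
rewrite (_ : ball p e = [set v | forall i, ball (p ord0 i) e (v ord0 i)]).
  apply: (@row_measurable_coord (fun i => ball (p ord0 i) e)) => i.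
  by apply: open_measurable; exact: ball_open.
apply/seteqP; split=> v /=; first by move=> [_ h] i; exact: h.
by move=> h; split=> // i j; rewrite ord1; exact: h.
Qed.

(** An open set is the countable union of the sup-norm balls of rational centre and radius
    [k.+1%:R^-1] that it contains; such balls are products of intervals. *)
Lemma open_row_measurable A : open A -> row_measurable A.
Proof.
move=> oA.
pose q2r (q : 'rV[rat]_d) : 'rV[R]_d := \row_i ratr (q ord0 i).
pose F (u : 'rV[rat]_d * nat) : set 'rV[R]_d :=
  if `[< ball (q2r u.1) u.2.+1%:R^-1 `<=` A >] then ball (q2r u.1) u.2.+1%:R^-1
  else set0.
rewrite (_ : A = \bigcup_u F u); last first.
  apply/seteqP; split=> x; last first.
    by move=> [u _]; rewrite /F; case: asboolP => // h /h.
  move=> Ax.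
  have /nbhs_ballP[e /= e0 he] : nbhs x A by exact: open_nbhs_nbhs.
  (* With a radius below [e / 2], a ball whose centre is that close to [x] contains [x] and stays
     inside [ball x e]. *)
  have [k] := ltr_add_invr (divr_gt0 e0 (ltr0n R 2)).
  rewrite add0r => ke.
  have k0 : 0 < k.+1%:R^-1 :> R by rewrite invr_gt0.
  have /choice[q hq] : forall i : 'I_d,
      exists q : rat, ball (x ord0 i) k.+1%:R^-1 (ratr q : R).
    move=> i; have [|q] := @rat_in_itvoo R (x ord0 i - k.+1%:R^-1) (x ord0 i + k.+1%:R^-1).
      by rewrite ltrD2l gtrN.
    rewrite in_itv /= => /andP[q1 q2]; exists q.
    by rewrite /ball /= ltr_norml; move: (ratr q) (k.+1%:R^-1) q1 q2 => r s; lra.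
  have bq : ball x k.+1%:R^-1 (q2r (\row_i q i)).
    by split=> // i j; rewrite !mxE ord1; exact: hq.
  exists (\row_i q i, k) => //; rewrite /F /=.
  case: asboolP => [_|]; first exact: ball_sym.
  case=> y qy; apply: he; apply: (@le_ball _ _ _ (k.+1%:R^-1 + k.+1%:R^-1)).
    by move: (k.+1%:R^-1) ke => s; lra.
  exact: ball_triangle bq qy.
rewrite /row_measurable (_ : mkset _ = \bigcup_u
    [set t : d.-tuple T | F u (\row_i tnth t i)]).
  apply: countable_bigcupT_measurable => // u.
  rewrite /F; case: asboolP => _; last exact: measurable0.
  exact: ball_row_measurable.
by apply/seteqP; split=> t /= [u _ h]; exists u.
Qed.

Lemma closed_row_measurable A : closed A -> row_measurable A.
Proof.
move=> cA; rewrite -[A]setCK; apply: row_measurable_setC.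
by apply: open_row_measurable; exact: closed_openC.
Qed.

Lemma le_vol A B : row_measurable A -> row_measurable B -> A `<=` B ->
  (vol A <= vol B)%E.
Proof.
by move=> mA mB AB; apply: le_measure; rewrite ?inE// => t /=; exact: AB.
Qed.

Lemma vol_affine_preimage p (c : R) A : 0 < c -> row_measurable A ->
  (vol [set v | A (p + c *: v)%R] = (c ^- d)%:E * vol A)%E.
Proof.
move=> c0 mA; pose q : d.-tuple T := [tuple p ord0 i | i < d].
rewrite /vol -(lebesgue_tuple_affine_preimage q c0 mA).
congr (lebesgue_tuple R d _); apply/funext => t /=; congr A.
by apply/rowP => i; rewrite !mxE /affine_tuple !tnth_mktuple.
Qed.

Lemma vol_box (a b : 'I_d -> R) : (forall i, a i <= b i) ->
  vol [set v | forall i, a i <= v ord0 i <= b i] = (\prod_(i < d) (b i - a i))%:E.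
Proof.
move=> ab; rewrite /vol -lebesgue_tuple_box//; congr (lebesgue_tuple R d _).
by apply/seteqP; split=> t /= h i; have := h i; rewrite mxE.
Qed.

Lemma box_row_measurable (a b : 'I_d -> R) :
  row_measurable [set v | forall i, a i <= v ord0 i <= b i].
Proof.
rewrite (_ : mkset _ = [set v | forall i, `[a i, b i]%classic (v ord0 i)]).
  by apply: (@row_measurable_coord (fun i => `[a i, b i]%classic)).
by apply/seteqP; split=> v /= h i; have := h i; rewrite in_itv.
Qed.

Definition sup_bounded (M : R) A := forall v, A v -> forall i, - M <= v ord0 i <= M.

(** [fine] sends an infinite volume to 0, so the lemmas comparing these values assume
    boundedness. *)
Definition rvol A : R := fine (vol A).

Lemma vol_fin_num M A : 0 <= M -> row_measurable A -> sup_bounded M A ->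
  vol A \is a fin_num.
Proof.
move=> M0 mA bA; rewrite ge0_fin_numE ?measure_ge0//.
apply: le_lt_trans (le_vol mA (box_row_measurable (fun=> - M) (fun=> M)) bA) _.
by rewrite vol_box ?ltry// => i; rewrite (le_trans _ M0)// oppr_le0.
Qed.

Lemma rvol_ge0 A : 0 <= rvol A.
Proof. by rewrite fine_ge0// measure_ge0. Qed.

Lemma le_rvol M A B : 0 <= M -> row_measurable A -> row_measurable B ->
  sup_bounded M B -> A `<=` B -> rvol A <= rvol B.
Proof.
move=> M0 mA mB bB AB; apply: fine_le.
- by apply: (vol_fin_num M0) => // v /AB/bB.
- exact: (vol_fin_num M0).
- exact: le_vol.
Qed.

Lemma rvolDI M A B : 0 <= M -> row_measurable A -> row_measurable B ->
  sup_bounded M A -> rvol A = rvol (A `\` B) + rvol (A `&` B).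
Proof.
move=> M0 mA mB bA; rewrite /rvol -fineD.
- by congr fine; exact: measureDI.
- apply: (vol_fin_num M0); first exact: row_measurable_setD.
  by move=> v [/bA].
- apply: (vol_fin_num M0); first exact: row_measurable_setI.
  by move=> v [/bA].
Qed.

(** [A] lies in the preimage of [B] under [v -> (1 - c) *: p + c *: v], whose volume is [c ^- d]
    times that of [B]. *)
Lemma rvol_homothety M A B p (c : R) : 0 <= M -> 0 < c ->
  row_measurable A -> row_measurable B -> sup_bounded M A -> sup_bounded M B ->
  (forall v, A v -> B (p + c *: (v - p))) -> c ^+ d * rvol A <= rvol B.
Proof.
move=> M0 c0 mA mB bA bB AB.
have cd0 : 0 < c ^+ d by rewrite exprn_gt0.
have fA := vol_fin_num M0 mA bA.
have fB := vol_fin_num M0 mB bB.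
have mB' : row_measurable [set v | B ((1 - c) *: p + c *: v)].
  have := @measurable_affine_tuple R d [tuple ((1 - c) *: p) ord0 i | i < d] c.
  move=> /(_ measurableT _ mB); rewrite setTI.
  congr measurable; apply/funext => t /=; congr B.
  by apply/rowP => i; rewrite !mxE /affine_tuple !tnth_mktuple mxE.
have : (vol A <= (c ^- d)%:E * vol B)%E.
  rewrite -(vol_affine_preimage ((1 - c) *: p) c0 mB); apply: le_vol => // v /AB /=.
  by congr B; rewrite scalerBl scale1r scalerBr addrA addrAC.
rewrite -(fineK fA) -(fineK fB) -EFinM lee_fin.
by rewrite -ler_pdivlMl// invrK.
Qed.

Lemma rvol_le M A : 0 <= M -> row_measurable A -> sup_bounded M A ->
  rvol A <= (M *+ 2) ^+ d.
Proof.
move=> M0 mA bA.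
have : (vol A <= ((M *+ 2) ^+ d)%:E)%E.
  rewrite (_ : (M *+ 2) ^+ d = \prod_(i < d) (M - - M)).
    rewrite -(@vol_box (fun=> - M) (fun=> M)); last first.
      by move=> i; rewrite (le_trans _ M0)// oppr_le0.
    exact: le_vol (box_row_measurable _ _) bA.
  by rewrite prodr_const card_ord opprK mulr2n.
by rewrite -(fineK (vol_fin_num M0 mA bA)) lee_fin.
Qed.

Lemma rvol_ge M A p (r : R) : 0 <= M -> 0 <= r -> row_measurable A ->
  sup_bounded M A ->
  (forall v : 'rV[R]_d, (forall i, p ord0 i - r <= v ord0 i <= p ord0 i + r) -> A v) ->
  (r *+ 2) ^+ d <= rvol A.
Proof.
move=> M0 r0 mA bA pA.
have : (((r *+ 2) ^+ d)%:E <= vol A)%E.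
  rewrite (_ : (r *+ 2) ^+ d = \prod_(i < d) ((p ord0 i + r) - (p ord0 i - r))).
    rewrite -vol_box; last by move=> i; rewrite lerD2l (le_trans _ r0)// oppr_le0.
    exact: le_vol (box_row_measurable _ _) mA pA.
  rewrite (eq_bigr (fun=> r *+ 2)); last by move=> i _; rewrite mulr2n; ring.
  by rewrite prodr_const card_ord.
by rewrite -(fineK (vol_fin_num M0 mA bA)) lee_fin.
Qed.

End vol_theory.

(** * Unit ball, half-spaces and Minkowski sums *)

Section geometry.
Variables (R : realType) (d : nat).
Implicit Types (S K : set 'rV[R]_d) (u v w x p : 'rV[R]_d).

Lemma dotvC u v : dotv u v = dotv v u.
Proof. by apply: eq_bigr => i _; rewrite mulrC. Qed.

Lemma dotvDl u v x : dotv (u + v) x = dotv u x + dotv v x.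
Proof. by rewrite /dotv -big_split; apply: eq_bigr => i _; rewrite mxE mulrDl. Qed.

Lemma dotvZl c v x : dotv (c *: v) x = c * dotv v x.
Proof. by rewrite /dotv mulr_sumr; apply: eq_bigr => i _; rewrite mxE mulrA. Qed.

Lemma dotvNl v x : dotv (- v) x = - dotv v x.
Proof. by rewrite -scaleN1r dotvZl mulN1r. Qed.

Lemma dotvNr v x : dotv v (- x) = - dotv v x.
Proof. by rewrite dotvC dotvNl dotvC. Qed.

Lemma dotvBl u v x : dotv (u - v) x = dotv u x - dotv v x.
Proof. by rewrite dotvDl dotvNl. Qed.

Lemma unit_ballE v : unit_ball R d v <-> dotv v v <= 1.
Proof.
rewrite /unit_ball /= -{1}sqrtr1; split => [|h]; last exact: ler_wsqrtr.
by rewrite ler_psqrt// ?nnegrE// sumr_ge0// => i _; exact: sqr_ge0.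
Qed.

Lemma unit_ballN v : unit_ball R d v -> unit_ball R d (- v).
Proof. by rewrite !unit_ballE dotvNl dotvNr opprK. Qed.

(** Summing [2ab <= a^2 + b^2] over the coordinates suffices, both norms being at most 1. *)
Lemma dotv_le1 u x : unit_ball R d u -> unit_ball R d x -> dotv u x <= 1.
Proof.
rewrite !unit_ballE => hu hx.
suff : dotv u x <= (dotv u u + dotv x x) / 2 by lra.
rewrite /dotv -big_split /= mulr_suml; apply: ler_sum => i _.
by have := sqr_ge0 (u ord0 i - x ord0 i); nra.
Qed.

Lemma dotv_geN1 u x : unit_ball R d u -> unit_ball R d x -> -1 <= dotv u x.
Proof. by move=> /unit_ballN hu hx; have := dotv_le1 hu hx; rewrite dotvNl; lra. Qed.

Lemma unit_ball_coord v : unit_ball R d v -> forall i, -1 <= v ord0 i <= 1.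
Proof.
rewrite unit_ballE => h i.
have : v ord0 i * v ord0 i <= 1.
  apply: le_trans h; rewrite /dotv (bigD1 i)//= lerDl sumr_ge0// => j _.
  exact: sqr_ge0.
by nra.
Qed.

(** Each square is at most [d^-2 <= d^-1]. Half-side [d^-1] instead of the sharp [d^(-1/2)] only
    affects the constant before [ln d] in the final bound. *)
Lemma cube_unit_ball v : (forall i, - d%:R^-1 <= v ord0 i <= d%:R^-1) ->
  unit_ball R d v.
Proof.
have [d0 _|d0 h] := posnP d.
  by rewrite unit_ballE /dotv big1 ?ler01// => i _; have := ltn_ord i; rewrite {2}d0.
have dR : 0 < d%:R :> R by rewrite ltr0n.
have di1 : d%:R^-1 <= 1 :> R by rewrite invf_le1// ler1n.
rewrite unit_ballE; apply: (@le_trans _ _ (\sum_(i < d) d%:R^-1)).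
  apply: ler_sum => i _; have := h i; have : 0 < d%:R^-1 :> R by rewrite invr_gt0.
  by move: di1; move: (d%:R^-1) (v ord0 i) => a b; nra.
by rewrite sumr_const card_ord -[_ *+ d]mulr_natl mulfV ?lt0r_neq0.
Qed.

Definition convex_rows S := forall u v c, S u -> S v -> 0 <= c <= 1 ->
  S (u + c *: (v - u)).

(** Expand the square of [(1 - c) u + c v] and bound all three inner products by 1; the coefficients
    sum to [((1 - c) + c)^2 = 1]. *)
Lemma unit_ball_convex : convex_rows (unit_ball R d).
Proof.
move=> u v c hu hv /andP[c0 c1]; have huv := dotv_le1 hu hv.
move: hu hv; rewrite !unit_ballE => hu hv.
rewrite dotvDl dotvZl dotvBl ![dotv _ (u + _)]dotvC !dotvDl !dotvZl !dotvBl.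
rewrite (dotvC v u).
have : (1 - c) ^+ 2 * dotv u u <= (1 - c) ^+ 2 by rewrite ler_piMr// sqr_ge0.
have : c ^+ 2 * dotv v v <= c ^+ 2 by rewrite ler_piMr// sqr_ge0.
have : c * (1 - c) * dotv u v <= c * (1 - c) by rewrite ler_piMr// mulr_ge0// subr_ge0.
move: (dotv u u) (dotv v v) (dotv u v) => a b e; nra.
Qed.

Lemma continuous_dotv (f g : 'rV[R]_d -> 'rV[R]_d) :
  continuous f -> continuous g -> continuous (fun v => dotv (f v) (g v)).
Proof.
move=> cf cg; apply: continuous_big => [|i _ v]; first exact: add_continuous.
apply: continuousM.
  exact: (continuous_comp (cf v) (@coord_continuous _ _ _ ord0 i _)).
exact: (continuous_comp (cg v) (@coord_continuous _ _ _ ord0 i _)).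
Qed.

Lemma continuous_dotvl x : continuous (fun v => dotv v x).
Proof.
by apply: (@continuous_dotv id (fun=> x)) => v; [move=> B|exact: (@cst_continuous _ _ x v)].
Qed.

Lemma closed_unit_ball : closed (unit_ball R d).
Proof.
rewrite (_ : unit_ball R d = (fun v => dotv v v) @^-1` [set a | a <= 1]).
  apply: (@preimage_closed _ _ (fun v => dotv v v)); last exact: closed_le.
  by move=> v _; apply: (@continuous_dotv id id) => {}v B.
by apply/seteqP; split=> v /=; rewrite unit_ballE.
Qed.

Lemma closed_halfspace_le x a : closed [set v | dotv v x <= a].
Proof.
apply: (@preimage_closed _ _ (fun v => dotv v x) [set b | b <= a]); last exact: closed_le.
by move=> v _; exact: continuous_dotvl.
Qed.

Lemma closed_halfspace_ge x a : closed [set v | a <= dotv v x].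
Proof.
apply: (@preimage_closed _ _ (fun v => dotv v x) [set b | a <= b]); last exact: closed_ge.
by move=> v _; exact: continuous_dotvl.
Qed.

Lemma closed_compact_unit_ball S : S `<=` unit_ball R d -> closed S -> compact S.
Proof.
move=> SB cS; apply: bounded_closed_compact => //.
exists 1; split=> // M M1 v /SB /unit_ball_coord hv /=.
apply: le_trans (ltW M1).
rewrite /Num.Def.normr /= mx_normrE; apply/bigmax_leP; split=> // -[i j] _ /=.
by rewrite ord1 ler_norml.
Qed.

(** Compactness turns the supremum into a value at a point; such points serve later as centres of
    homotheties. *)
Lemma max_along_attained S x : S !=set0 -> compact S ->
  exists2 p, S p & max_along S x = dotv p x /\ forall v, S v -> dotv v x <= dotv p x.
Proof.
move=> S0 cS; have [|p pS pmax] := @compact_EVT_max _ R (fun v => dotv v x) S S0 cS.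
  by apply: continuous_subspaceT; exact: continuous_dotvl.
have ub v : S v -> dotv v x <= dotv p x by move=> Sv; apply: pmax; rewrite inE.
exists p; first by rewrite inE in pS.
split=> //; apply/le_anti/andP; split.
  apply: ge_sup; first by exists (dotv p x), p; rewrite // inE in pS.
  by move=> _ [v Sv <-]; exact: ub.
apply: ub_le_sup; first by exists (dotv p x) => _ [v Sv <-]; exact: ub.
by exists p; rewrite // inE in pS.
Qed.

Lemma min_along_attained S x : S !=set0 -> compact S ->
  exists2 p, S p & min_along S x = dotv p x /\ forall v, S v -> dotv p x <= dotv v x.
Proof.
move=> S0 cS; have [|p pS pmin] := @compact_EVT_min _ R (fun v => dotv v x) S S0 cS.
  by apply: continuous_subspaceT; exact: continuous_dotvl.
have lb v : S v -> dotv p x <= dotv v x by move=> Sv; apply: pmin; rewrite inE.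
exists p; first by rewrite inE in pS.
split=> //; apply/le_anti/andP; split.
  apply: ge_inf; first by exists (dotv p x) => _ [v Sv <-]; exact: lb.
  by exists p; rewrite // inE in pS.
apply: lb_le_inf; first by exists (dotv p x), p; rewrite // inE in pS.
by move=> _ [v Sv <-]; exact: lb.
Qed.

Lemma minkowski_ball_sub S z : S `<=` minkowski_ball S z.
Proof.
move=> v Sv; exists v => //; exists 0; last by rewrite scaler0 addr0.
by rewrite unit_ballE -(scale0r 0) dotvZl mul0r ler01.
Qed.

Lemma minkowski_ballS S K z : S `<=` K -> minkowski_ball S z `<=` minkowski_ball K z.
Proof. by move=> SK _ [w Sw [u Bu <-]]; exists w; [exact: SK|exists u]. Qed.

Lemma minkowski_ball_convex S z : convex_rows S -> convex_rows (minkowski_ball S z).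
Proof.
move=> cS _ _ c [u1 Su1 [b1 Bb1 <-]] [u2 Su2 [b2 Bb2 <-]] hc.
exists (u1 + c *: (u2 - u1)); first exact: cS.
exists (b1 + c *: (b2 - b1)); first exact: unit_ball_convex.
by apply/rowP => i; rewrite !mxE; ring.
Qed.

(** The sum is the continuous image of the compact product of [S] and the unit ball. Closedness is
    the source of measurability for the expanded sets. *)
Lemma minkowski_ball_closed S z : compact S -> closed (minkowski_ball S z).
Proof.
move=> cS; apply: compact_closed; first exact: norm_hausdorff.
rewrite (_ : minkowski_ball S z =
    (fun q : 'rV[R]_d * 'rV[R]_d => q.1 + z *: q.2) @` (S `*` unit_ball R d)).
  apply: continuous_compact; last first.
    apply: compact_setX => //; apply: closed_compact_unit_ball => //.
    exact: closed_unit_ball.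
  apply: continuous_subspaceT => q.
  apply: cvgD; first exact: cvg_fst.
  by apply: cvgZr; exact: cvg_snd.
apply/seteqP; split=> v.
  by move=> [w Sw [u Bu <-]]; exists (w, u).
by move=> [[w u] [/= Sw Bu] <-]; exists w => //; exists u.
Qed.

Lemma minkowski_ball_sup_bounded S z : S `<=` unit_ball R d -> 0 <= z <= 1 ->
  sup_bounded 2 (minkowski_ball S z).
Proof.
move=> SB /andP[z0 z1] _ [w /SB/unit_ball_coord hw [u /unit_ball_coord hu <-]] i.
by rewrite !mxE; have := hw i; have := hu i; nra.
Qed.

Lemma minkowski_ball_dotv_ge S z x a : unit_ball R d x -> 0 <= z ->
  (forall v, S v -> a <= dotv v x) ->
  forall v, minkowski_ball S z v -> a - z <= dotv v x.
Proof.
move=> Bx z0 ha _ [w /ha hw [u Bu <-]].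
by rewrite dotvDl dotvZl; have := dotv_geN1 Bu Bx; nra.
Qed.

Lemma minkowski_ball_dotv_le S z x a : unit_ball R d x -> 0 <= z ->
  (forall v, S v -> dotv v x <= a) ->
  forall v, minkowski_ball S z v -> dotv v x <= a + z.
Proof.
move=> Bx z0 ha _ [w /ha hw [u Bu <-]].
by rewrite dotvDl dotvZl; have := dotv_le1 Bu Bx; nra.
Qed.

Lemma minkowski_ball_cube S z p : 0 < z -> S p ->
  forall v, (forall i, p ord0 i - z / d%:R <= v ord0 i <= p ord0 i + z / d%:R) ->
  minkowski_ball S z v.
Proof.
move=> z0 Sp v hv; exists p => //; exists (z^-1 *: (v - p)); last first.
  by rewrite scalerA mulfV ?lt0r_neq0// scale1r addrC subrK.
apply: cube_unit_ball => i; rewrite !mxE; have /andP[h1 h2] := hv i.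
rewrite ler_pdivlMl// ler_pdivrMl// mulrN; apply/andP; split; lra.
Qed.

End geometry.

(** * Caps of convex bodies *)

Lemma bernoulli_le (R : realDomainType) (a : R) n : 0 <= a <= 1 ->
  1 - a *+ n <= (1 - a) ^+ n.
Proof.
move=> /andP[a0 a1]; elim: n => [|n IH]; first by rewrite mulr0n subr0 expr0.
rewrite exprS mulrS; apply: le_trans (ler_wpM2l _ IH); last by rewrite subr_ge0.
have : 0 <= a * (a *+ n) by rewrite mulr_ge0// mulrn_wge0.
by move: (a *+ n) => b; nra.
Qed.

Section cuts.
Variables (R : realType) (d : nat).
Implicit Types (S K : set 'rV[R]_d) (v x p : 'rV[R]_d).

(* The homothety of ratio [c] centred at [p] maps the cap above [lo] into the
   cap above [hi]. *)
Lemma rvol_cap_ge K p x (c lo hi : R) : 0 < c <= 1 ->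
  convex_rows K -> closed K -> sup_bounded 2 K -> K p ->
  hi <= dotv p x + c * (lo - dotv p x) ->
  c ^+ d * rvol (K `&` [set v | lo <= dotv v x]) <=
    rvol (K `&` [set v | hi <= dotv v x]).
Proof.
move=> /andP[c0 c1] Kconv Kcl Kb Kp hhi.
have Kcap a : row_measurable (K `&` [set v | a <= dotv v x]).
  apply: closed_row_measurable; apply: closedI => //; exact: closed_halfspace_ge.
have bcap a : sup_bounded 2 (K `&` [set v | a <= dotv v x]) by move=> v [/Kb].
apply: (@rvol_homothety _ _ 2 _ _ p) => // v [Kv /= hv]; split.
  by apply: Kconv => //; rewrite (ltW c0).
rewrite /= dotvDl dotvZl dotvBl; apply: le_trans hhi _.
by rewrite lerD2l ler_wpM2l ?(ltW c0)// lerD2r.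
Qed.

(** Reflection of [rvol_cap_ge] by [x -> - x]. *)
Lemma rvol_cap_le K p x (c lo hi : R) : 0 < c <= 1 ->
  convex_rows K -> closed K -> sup_bounded 2 K -> K p ->
  dotv p x + c * (hi - dotv p x) <= lo ->
  c ^+ d * rvol (K `&` [set v | dotv v x <= hi]) <=
    rvol (K `&` [set v | dotv v x <= lo]).
Proof.
move=> hc Kconv Kcl Kb Kp hlo.
have capE a : [set v | dotv v x <= a] = [set v | - a <= dotv v (- x)].
  by apply/seteqP; split=> v /=; rewrite dotvNr lerN2.
by rewrite !capE; apply: (rvol_cap_ge hc Kconv Kcl Kb Kp); rewrite !dotvNr; lra.
Qed.

(** Besides the part above [m], the half-space keeps a slab of thickness [2z]. Along [x], the far
    face of this slab is at distance at least half of [w] from [p] or from [q]; contracting towards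
    that point moves a cap across the slab at the cost of a factor close to 1, so the slab holds
    little volume. *)
Lemma rvol_shallow_cut K p q x (m z f : R) :
  convex_rows K -> closed K -> sup_bounded 2 K -> K p -> K q ->
  0 < z -> 0 <= f <= 1 ->
  16 * (d%:R * z) <= f * (dotv p x - dotv q x) ->
  rvol (K `&` [set v | dotv v x <= m]) = f * rvol K ->
  (0 < d)%N ->
  rvol (K `&` [set v | m - z *+ 2 <= dotv v x]) <= (1 - 5 / 8 * f) * rvol K.
Proof.
move=> Kconv Kcl Kb Kp Kq z0 /andP[f0 f1] hz hm d0.
have d1 : 1 <= d%:R :> R by rewrite ler1n.
set w := dotv p x - dotv q x in hz.
have w0 : 0 < w by nra.
have mK : row_measurable K by exact: closed_row_measurable.
have mge a : row_measurable [set v | a <= dotv v x].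
  by apply: closed_row_measurable; exact: closed_halfspace_ge.
have mle a : row_measurable [set v | dotv v x <= a].
  by apply: closed_row_measurable; exact: closed_halfspace_le.
have splitge a := @rvolDI _ _ 2 _ _ (ler0n R 2) mK (mge a) Kb.
have splitle a := @rvolDI _ _ 2 _ _ (ler0n R 2) mK (mle a) Kb.
have VK0 := rvol_ge0 K.
set A := rvol (K `&` [set v | m - z *+ 2 <= dotv v x]).
have A0 : 0 <= A by exact: rvol_ge0.
(* From [16 d z <= f w] and [D >= w / 2] one gets [3 d z / D <= 3/8 f], and Bernoulli's inequality
   applies. The shift is [3z], not [2z], so that the moved closed cap is disjoint from the closed
   half-space on the other side. *)
have ratio D : w / 2 <= D -> 0 < 1 - 3 * z / D <= 1 /\
    1 - 3 / 8 * f <= (1 - 3 * z / D) ^+ d.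
  move=> hD; have D0 : 0 < D by apply: lt_le_trans hD; rewrite divr_gt0.
  have zD0 : 0 < 3 * z / D by rewrite divr_gt0// mulr_gt0.
  have zD : d%:R * (3 * z / D) <= 3 / 8 * f.
    rewrite mulrA ler_pdivrMr//; nra.
  have zD1 : 3 * z / D <= 3 / 8.
    by apply: le_trans (_ : d%:R * (3 * z / D) <= _); [rewrite ler_peMl// ltW|lra].
  split; first by apply/andP; split; lra.
  apply: le_trans (@bernoulli_le _ (3 * z / D) d _); last by apply/andP; split; lra.
  by rewrite -mulr_natl; lra.
(* Centre [p]: the cap above [m - 2z] moves above [m + z], where at most [(1 - f) * rvol K] is
   left. *)
have [hD|hD] := leP (w / 2) (dotv p x - (m - z *+ 2)).
  have [hc hcd] := ratio _ hD.
  have := @rvol_cap_ge K p x _ (m - z *+ 2) (m + z) hc Kconv Kcl Kb Kp.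
  have D0 : dotv p x - (m - z *+ 2) != 0 by rewrite lt0r_neq0// (lt_le_trans _ hD)// divr_gt0.
  set c := 1 - _ in hc hcd *.
  have -> : dotv p x + c * (m - z *+ 2 - dotv p x) = m + z.
    by rewrite /c -[_ - dotv p x]opprB mulrN mulrBl divfK// mul1r; ring.
  move=> /(_ (lexx _)); rewrite -/A => hcap.
  have h1 : rvol (K `&` [set v | m + z <= dotv v x]) <= rvol (K `\` [set v | dotv v x <= m]).
    apply: (@le_rvol _ _ 2) => //.
    - by apply: row_measurable_setI; [exact: mK|auto].
    - by apply: row_measurable_setD; [exact: mK|auto].
    - by move=> v [/Kb].
    - by move=> v [Kv /= hv]; split=> //= ; apply/negP; rewrite -ltNge; lra.
  have := splitle m; rewrite hm => h2.
  have h3 : A <= rvol K.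
    by rewrite (splitge (m - z *+ 2)) lerDr rvol_ge0.
  have h4 : (1 - 3 / 8 * f) * A <= c ^+ d * A by rewrite ler_wpM2r.
  have h5 : f * A <= f * rvol K by rewrite ler_wpM2l.
  nra.
(* Centre [q]: the cap below [m], of volume [f * rvol K], moves below [m - 3z], hence outside the
   retained part. *)
have hD' : w / 2 <= m - dotv q x by rewrite /w in hD *; lra.
have [hc hcd] := ratio _ hD'.
have := @rvol_cap_le K q x _ (m - 3 * z) m hc Kconv Kcl Kb Kq.
have D0 : m - dotv q x != 0 by rewrite lt0r_neq0// (lt_le_trans _ hD')// divr_gt0.
set c := 1 - _ in hc hcd *.
have -> : dotv q x + c * (m - dotv q x) = m - 3 * z.
  by rewrite /c mulrBl divfK// mul1r; ring.
move=> /(_ (lexx _)); rewrite hm => hcap.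
have h1 : rvol (K `&` [set v | dotv v x <= m - 3 * z]) <=
    rvol (K `\` [set v | m - z *+ 2 <= dotv v x]).
  apply: (@le_rvol _ _ 2) => //.
  - by apply: row_measurable_setI; [exact: mK|auto].
  - by apply: row_measurable_setD; [exact: mK|auto].
  - by move=> v [/Kb].
  - by move=> v [Kv /= hv]; split=> //= ; apply/negP; rewrite -ltNge; lra.
have := splitge (m - z *+ 2); rewrite -/A => h2.
have fV : 0 <= f * rvol K by rewrite mulr_ge0.
have h4 : (1 - 3 / 8 * f) * (f * rvol K) <= c ^+ d * (f * rvol K) by rewrite ler_wpM2r.
have h5 : f * (f * rvol K) <= f * rvol K by rewrite ler_piMl.
nra.
Qed.

End cuts.

(** * The pricing algorithm *)

Section scales.
Variables (R : realType).
Local Notation f := (mass_fraction R).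

(** This is [- ln (mass_fraction R i)]; dividing by 2 avoids the exponent [i - 1] at [i = 0]. *)
Definition rate i : R := 2 ^+ i * ln 2 / 2.

(** Follows from [1 - 1/2 <= expR (- 1/2)]. *)
Lemma half_le_ln2 : 2^-1 <= ln 2 :> R.
Proof.
rewrite -ler_expR lnK ?posrE//.
have := expR_ge1Dx (- 2^-1 : R); rewrite expRN => h.
rewrite -(invrK (expR 2^-1)) -[leRHS]invrK lef_pV2 ?posrE ?invr_gt0 ?expR_gt0//; lra.
Qed.

Lemma ln2_gt0 : 0 < ln 2 :> R.
Proof. by apply: lt_le_trans half_le_ln2. Qed.

Lemma rate_gt0 i : 0 < rate i.
Proof. by rewrite divr_gt0// mulr_gt0// ?exprn_gt0// ln2_gt0. Qed.

Lemma mass_fractionE i : f i = expR (- rate i).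
Proof.
rewrite /mass_fraction /powR !pnatr_eq0 /= mulNr; congr (expR (- _)).
rewrite mulrBl mul1r expRB expRM_natl lnK ?posrE// /rate.
by rewrite mulrAC.
Qed.

(** With all parameters of a scale written as powers of [f i], their comparisons become polynomial
    inequalities. *)
Lemma scaleE i : scale R i = f i ^+ 2.
Proof.
rewrite mass_fractionE -expRM_natl /scale /powR pnatr_eq0 /=; congr expR.
by rewrite /rate; field.
Qed.

Lemma scaleSE i : scale R i.+1 = f i ^+ 4.
Proof.
rewrite mass_fractionE -expRM_natl /scale /powR pnatr_eq0 /=; congr expR.
by rewrite /rate exprS; field.
Qed.

Lemma expansionE d i : expansion R d i = f i ^+ 6 / (16 * d%:R).
Proof.
rewrite mass_fractionE -expRM_natl /expansion /powR pnatr_eq0 /=; congr (expR _ / _).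
by rewrite /rate; field.
Qed.

Lemma mass_fraction_gt0 i : 0 < f i.
Proof. by rewrite mass_fractionE expR_gt0. Qed.

Lemma mass_fraction_le1 i : f i <= 1.
Proof. by rewrite mass_fractionE expR_le1 oppr_le0 ltW// rate_gt0. Qed.

(** Since [expR a >= 1 + a]. This lets the loss of an underpriced round be charged at the same
    price, [8 / rate], as an overpriced one. *)
Lemma mass_fraction_le_rate i : f i <= (rate i)^-1.
Proof.
rewrite mass_fractionE expRN lef_pV2 ?posrE ?expR_gt0 ?rate_gt0//.
by have := expR_ge1Dx (rate i); lra.
Qed.

Lemma mass_fraction0_sqr : f 0 ^+ 2 = 2^-1.
Proof. by rewrite -scaleE /scale expr0 powR_inv1. Qed.

Lemma expansion_gt0 d i : (0 < d)%N -> 0 < expansion R d i.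
Proof.
by move=> d0; rewrite expansionE divr_gt0 ?exprn_gt0 ?mass_fraction_gt0// mulr_gt0// ltr0n.
Qed.

Lemma expansion_mul d i : (0 < d)%N -> 16 * (d%:R * expansion R d i) = f i ^+ 6.
Proof.
by move=> d0; rewrite expansionE mulrA mulrC divfK// mulf_neq0// pnatr_eq0 -lt0n.
Qed.

Lemma expansion_le d i : (0 < d)%N -> 16 * expansion R d i <= f i ^+ 6.
Proof.
move=> d0; rewrite -(expansion_mul i d0) ler_pM2l// ler_peMl ?ler1n//.
exact/ltW/expansion_gt0.
Qed.

(** The lower bound is the maximality of [i], as [f i ^+ 4] is the next scale. The factor 4
    accommodates the fallback to index 0, where [w] may reach 2 while [f 0 ^+ 2 = 1/2]. *)
Lemma scale_index_bounds w i : w <= 2 -> scale_index w i ->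
  f i ^+ 4 < w <= 4 * f i ^+ 2.
Proof.
have F0 := mass_fraction0_sqr.
move=> w2 [[wi maxi]|[w0 ->]].
  rewrite -scaleE -scaleSE ltNge; apply/andP; split.
    by apply/negP => /maxi; rewrite ltnn.
  by rewrite scaleE in wi *; have := sqr_ge0 (f i); lra.
rewrite scaleE F0 in w0; rewrite (exprM _ 2 2) F0; apply/andP; split; lra.
Qed.

End scales.

(** * Analysis of a single run of the algorithm *)

Section rounds.
Variables (R : realType) (d T : nat) (v0 : 'rV[R]_d).
Variables (x : nat -> 'rV[R]_d) (y sigma : nat -> R).
Hypothesis d0 : (0 < d)%N.
Hypothesis Bv0 : unit_ball R d v0.
Hypothesis Bx : forall t, (1 <= t <= T)%N -> unit_ball R d (x t).
Hypothesis fb : forall t, (1 <= t <= T)%N -> feedback (y t) (dotv v0 (x t)) (sigma t).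
Hypothesis guess : forall t, (1 <= t <= T)%N ->
  steiner_pricing_guess T (knowledge_set x y sigma t) (x t) (y t).

Local Notation S := (knowledge_set x y sigma).
Local Notation z := (expansion R d).
Local Notation K := (fun i t => minkowski_ball (S t) (z i)).

Lemma knowledge_setSE t : (0 < t)%N ->
  S t.+1 = S t `&` [set v | 0 <= sigma t * (y t - dotv v (x t))].
Proof.
move=> t0; apply/seteqP; split=> v /=.
  move=> [Bv h]; split; last by apply: h; rewrite t0 ltnSn.
  by split=> // tau /andP[t1 t2]; apply: h; rewrite t1 ltnS ltnW.
move=> [[Bv h] ht]; split=> // tau /andP[t1]; rewrite ltnS leq_eqVlt => /predU1P[->//|t2].
by apply: h; rewrite t1.
Qed.

Lemma knowledge_set_sub t : S t `<=` unit_ball R d.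
Proof. by move=> v []. Qed.

(** Feedback is consistent with [v0] up to round [T], hence the range up to [T.+1]. In case of
    equality the sign is arbitrary but the constraint reads [0 <= 0]. *)
Lemma knowledge_set_mem t : (t <= T.+1)%N -> S t v0.
Proof.
move=> tT; split=> // tau /andP[t1 t2].
have tauT : (1 <= tau <= T)%N by rewrite t1 -ltnS (leq_trans t2).
have [hs h1 h2] := fb tauT.
have [yu|uy|->] := ltgtP (y tau) (dotv v0 (x tau)); last by rewrite subrr mulr0.
- by rewrite (h2 yu); lra.
- by rewrite (h1 uy); lra.
Qed.

Lemma knowledge_set_convex t : convex_rows (S t).
Proof.
move=> u v c [Bu hu] [Bv hv] hc; split; first exact: unit_ball_convex.
move=> tau ht; rewrite dotvDl dotvZl dotvBl.
have /andP[c0 c1] := hc.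
have := hu _ ht; have := hv _ ht.
move: (dotv u _) (dotv v _) => a b h1 h2.
rewrite (_ : _ * _ = (1 - c) * (sigma tau * (y tau - a)) +
                      c * (sigma tau * (y tau - b))); last by ring.
by rewrite addr_ge0// mulr_ge0// subr_ge0.
Qed.

Lemma knowledge_set_closed t : closed (S t).
Proof.
rewrite (_ : S t = unit_ball R d `&` \bigcap_(tau in [set tau | (1 <= tau < t)%N])
    [set v | 0 <= sigma tau * (y tau - dotv v (x tau))]).
  apply: closedI; first exact: closed_unit_ball.
  apply: closed_bigI => tau _.
  rewrite (_ : mkset _ = [set v | dotv v (sigma tau *: x tau) <= sigma tau * y tau]).
    exact: closed_halfspace_le.
  by apply/seteqP; split=> v /=; rewrite [dotv v (_ *: _)]dotvC dotvZl dotvC mulrBr subr_ge0.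
by apply/seteqP; split.
Qed.

Lemma knowledge_set_compact t : compact (S t).
Proof.
apply: closed_compact_unit_ball (@knowledge_set_closed t).
exact: knowledge_set_sub.
Qed.

Lemma expansion_le1 i : z i <= 1.
Proof.
have := @expansion_le R d i d0.
by have := exprn_ile1 6 (ltW (mass_fraction_gt0 R i)) (mass_fraction_le1 R i); lra.
Qed.

Lemma expanded_closed i t : closed (K i t).
Proof. exact/minkowski_ball_closed/knowledge_set_compact. Qed.

Lemma expanded_measurable i t : row_measurable (K i t).
Proof. by apply: closed_row_measurable; exact: expanded_closed. Qed.

Lemma expanded_bounded i t : sup_bounded 2 (K i t).
Proof.
apply: minkowski_ball_sup_bounded; first exact: knowledge_set_sub.
by rewrite (ltW (expansion_gt0 R i d0)) expansion_le1.
Qed.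

Lemma rvol_expanded_ge t i : (t <= T.+1)%N ->
  ((z i / d%:R) *+ 2) ^+ d <= rvol (K i t).
Proof.
move=> tT; apply: (@rvol_ge _ _ 2 _ v0) => //.
- by rewrite divr_ge0// ltW// expansion_gt0.
- exact: expanded_measurable.
- exact: expanded_bounded.
- apply: minkowski_ball_cube; first exact: expansion_gt0.
  exact: knowledge_set_mem.
Qed.

Lemma cube_side_gt0 i : 0 < (z i / d%:R) *+ 2.
Proof. by rewrite pmulrn_lgt0// divr_gt0 ?ltr0n// expansion_gt0. Qed.

Lemma rvol_expanded_gt0 i t : (t <= T.+1)%N -> 0 < rvol (K i t).
Proof.
by move=> tT; apply: lt_le_trans (rvol_expanded_ge i tT); rewrite exprn_gt0// cube_side_gt0.
Qed.

Lemma rvol_expanded_le i t : (0 < t)%N -> rvol (K i t.+1) <= rvol (K i t).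
Proof.
move=> t0; apply: (@le_rvol _ _ 2) => //; try exact: expanded_measurable.
  exact: expanded_bounded.
by apply: minkowski_ballS; rewrite knowledge_setSE// => v [].
Qed.

(** There is one potential per scale: a costly round is paid for by the potential of its own index,
    and no round increases any of them. *)
Definition potential i t : R := ln (rvol (K i t)).

Lemma potential_drop i t : (1 <= t <= T)%N -> 0 <= potential i t - potential i t.+1.
Proof.
move=> /andP[t1 tT]; rewrite subr_ge0 ler_ln ?posrE ?rvol_expanded_gt0//.
- exact: rvol_expanded_le.
- exact: leqW.
Qed.

Lemma potential_drop_ge i t a : (1 <= t <= T)%N ->
  rvol (K i t.+1) <= expR (- a) * rvol (K i t) ->
  a <= potential i t - potential i t.+1.
Proof.
move=> /andP[t1 tT] h.
have V0 : 0 < rvol (K i t) by apply: rvol_expanded_gt0; exact: leqW.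
have : potential i t.+1 <= ln (expR (- a) * rvol (K i t)).
  by rewrite ler_ln ?posrE ?rvol_expanded_gt0// mulr_gt0// expR_gt0.
rewrite lnM ?posrE ?expR_gt0// expRK /potential; lra.
Qed.

(** The first expanded set lies in a cube of side 4, and the last one contains a cube of side
    [2 z / d] around [v0]. *)
Lemma potential_total i : potential i 1 - potential i T.+1 <=
  d%:R * (6 * rate R i + ln 32 + ln d%:R *+ 2).
Proof.
have dR : 0 < d%:R :> R by rewrite ltr0n.
have h1 : potential i 1 <= ln 4 *+ d.
  rewrite -lnXn// ler_ln ?posrE ?rvol_expanded_gt0// ?exprn_gt0//.
  have := @rvol_le R d 2 (K i 1) (ler0n _ _) (expanded_measurable i 1) (@expanded_bounded i 1).
  by rewrite (_ : 2 *+ 2 = 4 :> R)//; ring.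
have h2 : ln ((z i / d%:R) *+ 2) *+ d <= potential i T.+1.
  rewrite -lnXn ?cube_side_gt0// ler_ln ?posrE ?rvol_expanded_gt0// ?exprn_gt0 ?cube_side_gt0//.
  exact: rvol_expanded_ge.
apply: le_trans (lerB h1 h2) _; rewrite -mulrnBl -[leLHS]mulr_natl ler_pM2l//.
rewrite expansionE mass_fractionE -expRM_natl.
(* The numerator 4 is kept so that its logarithm cancels the [ln 4] of the outer cube. *)
rewrite (_ : _ *+ 2 = expR (- (6 * rate R i)) * 4 / (32 * d%:R ^+ 2)); last first.
  by rewrite mulrN mulr2n; field; rewrite lt0r_neq0.
rewrite ln_div ?posrE ?mulr_gt0 ?expR_gt0 ?exprn_gt0//.
rewrite !lnM ?posrE ?expR_gt0 ?exprn_gt0// expRK; lra.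
Qed.

(** The guess is the minimum over a set containing [v0], so it never overprices, and the loss is at
    most the width. *)
Lemma cheap_round t : (1 <= t <= T)%N -> width (S t) (x t) <= T%:R^-1 ->
  pricing_loss (y t) (dotv v0 (x t)) <= T%:R^-1.
Proof.
move=> ht hw; have [/(_ hw) yE _] := guess ht.
have /andP[t1 tT] := ht.
have Sv0 : S t v0 by apply: knowledge_set_mem; exact: leqW.
have S0 : S t !=set0 by exists v0.
have [p Sp [maxE pmax]] := max_along_attained (x t) S0 (@knowledge_set_compact t).
have [q Sq [minE qmin]] := min_along_attained (x t) S0 (@knowledge_set_compact t).
move: hw; rewrite /width maxE minE => hw; rewrite minE in yE.
rewrite /pricing_loss yE qmin// mulr1.
by have := pmax _ Sv0; lra.
Qed.

(* Overpricing costs at most 1 but removes all but a fraction [expR (- rate)]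
   of the expanded set; underpricing costs O(f ^+ 2) and removes a fraction
   5/8 f of it, where f <= 1 / rate. *)
Lemma costly_round t : (1 <= t <= T)%N -> T%:R^-1 < width (S t) (x t) ->
  exists2 i, scale_index (width (S t) (x t)) i &
    pricing_loss (y t) (dotv v0 (x t)) <=
      8 / rate R i * (potential i t - potential i t.+1).
Proof.
move=> ht hw; have [_ /(_ hw) [i [m [hi hm yE]]]] := guess ht.
exists i => //.
have /andP[t1 tT] := ht.
have Sv0 : S t v0 by apply: knowledge_set_mem; exact: leqW.
have S0 : S t !=set0 by exists v0.
have [p Sp [maxE pmax]] := max_along_attained (x t) S0 (@knowledge_set_compact t).
have [q Sq [minE qmin]] := min_along_attained (x t) S0 (@knowledge_set_compact t).
have Bxt := Bx ht.
set w := width _ _ in hw hi.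
have wE : w = dotv p (x t) - dotv q (x t) by rewrite /w /width maxE minE.
have w2 : w <= 2.
  rewrite wE; have := dotv_le1 (knowledge_set_sub Sp) Bxt.
  by have := dotv_geN1 (knowledge_set_sub Sq) Bxt; lra.
have /andP[w_gt w_le] := scale_index_bounds w2 hi.
have z0 := expansion_gt0 R i d0.
have f0 := mass_fraction_gt0 R i.
have f1 := mass_fraction_le1 R i.
have fr := mass_fraction_le_rate R i.
have rate0 := rate_gt0 R i.
have z16 := @expansion_le R d i d0.
have zd := @expansion_mul R d i d0.
have fin : vol (K i t) \is a fin_num.
  apply: (@vol_fin_num _ _ 2) => //; first exact: expanded_measurable.
  exact: expanded_bounded.
have hmR : rvol (K i t `&` [set v | dotv v (x t) <= m]) =
    mass_fraction R i * rvol (K i t).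
  by rewrite /rvol -[X in X * _]/(fine (mass_fraction R i)%:E) -fineM// -hm.
have V0 : 0 < rvol (K i t) by apply: rvol_expanded_gt0; exact: leqW.
have mcap a : row_measurable (K i t `&` [set v | dotv v (x t) <= a]).
  apply: closed_row_measurable; apply: closedI; first exact: expanded_closed.
  exact: closed_halfspace_le.
have mcap' a : row_measurable (K i t `&` [set v | a <= dotv v (x t)]).
  apply: closed_row_measurable; apply: closedI; first exact: expanded_closed.
  exact: closed_halfspace_ge.
have drop0 := potential_drop i ht.
have SE := knowledge_setSE t1.
have KS v : K i t.+1 v -> K i t v.
  by apply: minkowski_ballS; rewrite SE => u [].
have [_ sp sn] := fb ht.
have [yu|uy|yu] := ltgtP (y t) (dotv v0 (x t)).
- rewrite /pricing_loss (ltW yu) mulr1.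
  (* Otherwise the cap below [m] would be empty, against its positive mass. This keeps the guess
     within [2 z i] of the minimum. *)
  have m_ge : dotv q (x t) - z i <= m.
    rewrite leNgt; apply/negP => hlt.
    have : rvol (K i t `&` [set v | dotv v (x t) <= m]) = 0.
      rewrite (_ : _ `&` _ = set0); first by rewrite /rvol /vol measure0.
      apply/seteqP; split=> // v [Kv /= hv].
      by have := minkowski_ball_dotv_ge Bxt (ltW z0) qmin Kv; lra.
    by rewrite hmR => /eqP; rewrite mulf_eq0 !gt_eqF.
  (* The feedback puts [S t.+1] above [m - z i], hence its expansion above [m - 2 z i], and
     [rvol_shallow_cut] applies. *)
  have drop : 5 / 8 * mass_fraction R i <= potential i t - potential i t.+1.
    apply: potential_drop_ge => //.
    apply: (@le_trans _ _ ((1 - 5 / 8 * mass_fraction R i) * rvol (K i t))); last first.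
      by rewrite ler_pM2r// -[1 - _]/(1 + - _) expR_ge1Dx.
    apply: le_trans (_ : rvol (K i t `&` [set v | m - z i *+ 2 <= dotv v (x t)]) <= _).
      apply: (@le_rvol _ _ 2) => //; first exact: expanded_measurable.
        by move=> v [/expanded_bounded].
      move=> v Kv; split; first exact: KS.
      have := @minkowski_ball_dotv_ge _ _ (S t.+1) (z i) (x t) (y t) Bxt (ltW z0).
      move=> /(_ _ v Kv) /=; rewrite yE => h; rewrite (_ : m - _ = m - z i - z i); last by ring.
      apply: h => u; rewrite SE => -[_ /=]; rewrite (sn yu) -yE; lra.
    apply: (@rvol_shallow_cut _ _ _ p q) => //.
    - exact/minkowski_ball_convex/knowledge_set_convex.
    - exact: expanded_closed.
    - exact: expanded_bounded.
    - exact: minkowski_ball_sub.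
    - exact: minkowski_ball_sub.
    - by rewrite (ltW f0).
    (* [16 d z = f^6 = f^2 * f^4 <= f * w], because [w] exceeds the next scale [f^4]. *)
    - rewrite -wE zd (exprD _ 2 4).
      rewrite ler_pM ?exprn_ge0 ?(ltW f0) ?(ltW w_gt)//.
      by rewrite expr2 ler_piMl// ltW.
  have f6 : mass_fraction R i ^+ 6 <= mass_fraction R i ^+ 2.
    by rewrite ler_wiXn2l// ltW.
  (* The loss is at most [w + 2 z <= 4 f^2 + f^6 / 8]. *)
  apply: (@le_trans _ _ (5 * mass_fraction R i ^+ 2)).
    by have := pmax _ Sv0; rewrite yE; lra.
  apply: (@le_trans _ _ (8 * (rate R i)^-1 * (5 / 8 * mass_fraction R i))); last first.
    by rewrite ler_wpM2l// mulr_ge0// invr_ge0 ltW.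
  rewrite expr2; nra.
- rewrite /pricing_loss (lt_geF uy) mulr0 subr0.
  (* Now [S t.+1] lies below [m - z i]; the offset [z i] in the guess exactly absorbs the expansion,
     which stays below [m]. *)
  have drop : rate R i <= potential i t - potential i t.+1.
    apply: potential_drop_ge => //; rewrite -mass_fractionE -hmR.
    apply: (@le_rvol _ _ 2) => //; first exact: expanded_measurable.
      by move=> v [/expanded_bounded].
    move=> v Kv; split; first exact: KS.
    have := @minkowski_ball_dotv_le _ _ (S t.+1) (z i) (x t) (y t) Bxt (ltW z0).
    move=> /(_ _ v Kv) /=; rewrite {2}yE subrK; apply.
    by move=> u; rewrite SE => -[_ /=]; rewrite (sp uy); lra.
  apply: le_trans (dotv_le1 Bv0 Bxt) _.
  have : 1 <= (rate R i)^-1 * (potential i t - potential i t.+1).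
    by rewrite ler_pdivlMl// mulr1.
  by rewrite -mulrA; lra.
- rewrite /pricing_loss yu lexx mulr1 subrr mulr_ge0//.
  by rewrite divr_ge0// ltW.
Qed.

End rounds.

(** * Summation over the rounds *)

(** The sixth power of [5/6 <= expR (- 1/6)] is just above [1/3]. *)
Lemma ln3_gt1 (R : realType) : 1 < ln 3 :> R.
Proof.
rewrite -ltr_expR lnK ?posrE//.
have h : (5 / 6) ^+ 6 <= expR (- 1) :> R.
  rewrite (_ : - 1 = 6%:R * (- 6^-1)); last by field.
  rewrite expRM_natl lerXn2r ?nnegrE ?expR_ge0//.
  by have := expR_ge1Dx (- 6^-1 : R); lra.
have e3 : 3^-1 < expR (- 1) :> R by apply: lt_le_trans h; lra.
by rewrite expRN ltf_pV2 ?posrE ?expR_gt0// in e3.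
Qed.

(** A geometric series with sum below [4 / ln 2]. Since the bound is independent of [n], the
    [d ln d] cost per scale is not multiplied by the number of scales. *)
Lemma sum_rateV (R : realType) n : \sum_(i < n) (rate R i)^-1 <= 8.
Proof.
have ln20 := ln2_gt0 R.
have -> : \sum_(i < n) (rate R i)^-1 = 4 / ln 2 * (1 - 2^-1 ^+ n).
  elim: n => [|n IH]; first by rewrite big_ord0 expr0 subrr mulr0.
  by rewrite big_ord_recr /= IH /rate exprS !exprVn; field; rewrite expf_neq0// lt0r_neq0.
apply: (@le_trans _ _ (4 / ln 2)).
  by rewrite ler_piMr ?divr_ge0 ?(ltW ln20)// gerBl exprn_ge0.
by rewrite ler_pdivrMr//; have := half_le_ln2 R; lra.
Qed.

(** From [1/T < w <= 2^(-2^i)] follows [2^i <= log2 T], so [i] is at most [b], the iterated binary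
    logarithm of [T]. *)
Lemma scale_index_count (R : realType) (T : nat) : (2 <= T)%N ->
  exists n : nat, n%:R <= 3 + 2 * ln (ln T%:R) :> R /\
    forall w i, T%:R^-1 < w -> scale_index (R:=R) w i -> (i < n)%N.
Proof.
move=> T2; have ln20 := ln2_gt0 R; have hln2 := half_le_ln2 R.
have T0 : 0 < T%:R :> R by rewrite ltr0n (leq_trans _ T2).
have lnT : ln 2 <= ln T%:R :> R by rewrite ler_ln ?posrE// ler_nat.
have lnT0 : 0 < ln T%:R :> R by apply: lt_le_trans lnT.
have q1 : 1 <= ln T%:R / ln 2 :> R by rewrite ler_pdivlMr// mul1r.
have lq0 := ln_ge0 q1.
set b := ln (ln T%:R / ln 2) / ln 2 :> R.
have b0 : 0 <= b by rewrite divr_ge0// ltW.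
exists (Num.truncn b).+1; split.
  have : (Num.truncn b)%:R <= b by rewrite truncn_le.
  have : b <= 2 * ln (ln T%:R / ln 2).
    by rewrite /b ler_pdivrMr//; nra.
  (* Passing from [log2 T] to [ln T] costs [- 2 ln (ln 2) <= 2]; with the successor this makes the
     constant 3. *)
  have : - ln (ln 2) <= 1 :> R.
    have V0 : 0 < (ln 2)^-1 :> R by rewrite invr_gt0.
    have V2 : (ln 2)^-1 <= 2 :> R by rewrite -[leRHS]invrK lef_pV2 ?posrE.
    rewrite -lnV ?posrE//.
    have := @le_ln1Dx R ((ln 2)^-1 - 1); rewrite (_ : 1 + _ = (ln 2)^-1) => [h|]; last by ring.
    by apply: le_trans (h _) _; lra.
  rewrite ln_div ?posrE// -natr1; lra.
move=> w i wT hi; rewrite ltnS truncn_ge_nat//.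
case: hi => [[wi _]|[_ ->]]; last by [].
rewrite /b ler_pdivlMr// mulr_natl -lnXn// ler_ln ?posrE ?exprn_gt0 ?divr_gt0//.
rewrite ler_pdivlMr// -ler_expR lnK ?posrE//.
have := lt_le_trans wT wi; rewrite scaleE mass_fractionE -expRM_natl mulrN.
rewrite expRN ltf_pV2 ?posrE ?expR_gt0// => /ltW; apply: le_trans.
by rewrite ler_expR /rate; lra.
Qed.

(** Cheap rounds cost 1 in total. Scale [i] costs [8 / rate] times its total decrease; the
    [6 * rate] part gives 48 per scale, hence [48 * (3 + 2 ln (ln T))], and the rest sums to [8 * 8]
    times the logarithmic terms. *)
Lemma total_pricing_loss (R : realType) (d T : nat) (v0 : 'rV[R]_d)
    (x : nat -> 'rV[R]_d) (y sigma : nat -> R) :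
  (1 <= d)%N -> (2 <= T)%N -> unit_ball R d v0 ->
  (forall t, (1 <= t <= T)%N -> unit_ball R d (x t)) ->
  (forall t, (1 <= t <= T)%N -> feedback (y t) (dotv v0 (x t)) (sigma t)) ->
  (forall t, (1 <= t <= T)%N ->
    steiner_pricing_guess T (knowledge_set x y sigma t) (x t) (y t)) ->
  \sum_(1 <= t < T.+1) pricing_loss (y t) (dotv v0 (x t)) <=
    1 + d%:R * (144 + 96 * ln (ln T%:R) + 64 * (ln 32 + ln d%:R *+ 2)).
Proof.
move=> d0 T2 Bv0 Bx fb guess.
have [n [n_le n_gt]] := scale_index_count R T2.
have T0 : 0 < T%:R :> R by rewrite ltr0n (leq_trans _ T2).
have dR : 0 < d%:R :> R by rewrite ltr0n.
have lnd0 : 0 <= ln d%:R :> R by rewrite ln_ge0// ler1n.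
have ln320 : 0 <= ln 32 :> R by rewrite ln_ge0// ler1n.
pose drop i t := potential x y sigma i t - potential x y sigma i t.+1.
have drop0 i t : (1 <= t <= T)%N -> 0 <= 8 / rate R i * drop i t.
  move=> ht; rewrite mulr_ge0//; first by rewrite divr_ge0// ltW// rate_gt0.
  exact: (potential_drop d0 Bv0 fb).
(* Each round is charged to the decreases at all scales, which are nonnegative, so that the sums can
   be exchanged and telescoped. *)
have round t : (1 <= t < T.+1)%N -> pricing_loss (y t) (dotv v0 (x t)) <=
    T%:R^-1 + \sum_(i < n) 8 / rate R i * drop i t.
  rewrite ltnS => ht; have sum0 : 0 <= \sum_(i < n) 8 / rate R i * drop i t.
    by apply: sumr_ge0 => i _; exact: drop0.
  have [hw|hw] := leP (width (knowledge_set x y sigma t) (x t)) T%:R^-1.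
    by have := cheap_round Bv0 fb guess ht hw; lra.
  have [i /(n_gt _ _ hw) i_n] := costly_round d0 Bv0 Bx fb guess ht hw.
  move=> /le_trans; apply; rewrite (bigD1 (Ordinal i_n))//= addrCA lerDl.
  rewrite addr_ge0 ?invr_ge0 ?(ltW T0)//.
  by apply: sumr_ge0 => j _; exact: drop0.
rewrite big_nat_cond; apply: le_trans (ler_sum _ _) _.
  by move=> t /andP[ht _]; exact: round ht.
rewrite -big_nat_cond big_split /= sumr_const_nat subSS subn0 -[_ *+ T]mulr_natl mulfV ?lt0r_neq0//.
rewrite lerD2l exchange_big /=.
apply: (@le_trans _ _ (\sum_(i < n) d%:R * (48 + 8 * (ln 32 + ln d%:R *+ 2) * (rate R i)^-1))).
  apply: ler_sum => i _; rewrite -mulr_sumr.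
  rewrite (@telescope_sumr_eq _ 1 T.+1 (fun t => - potential x y sigma i t))//; last first.
    by move=> t _; rewrite /drop opprK addrC.
  rewrite opprK addrC.
  have r0 := rate_gt0 R i.
  apply: le_trans (ler_wpM2l _ (potential_total d0 Bv0 fb i)) _.
    by rewrite divr_ge0// ltW.
  by rewrite le_eqVlt; apply/orP; left; apply/eqP; field; rewrite lt0r_neq0.
rewrite -mulr_sumr ler_pM2l// big_split /= -mulr_sumr sumr_const card_ord.
have := sum_rateV R n; set s := \sum_(i < n) _ => s8.
have : (ln 32 + ln d%:R *+ 2) * s <= (ln 32 + ln d%:R *+ 2) * 8.
  by rewrite ler_wpM2l// addr_ge0// mulrn_wge0.
rewrite -mulr_natl; lra.
Qed.

Unset Implicit Arguments.
Set Strict Implicit.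

(** For [T >= 3] the quantity [ln (ln T)] is at least [ln (ln 3) > 0], so additive constants can be
    absorbed into it, even for [d = 1] where [ln d] vanishes. *)
Theorem mainTheorem2 (R : realType) :
  exists2 C : R, 0 < C &
    forall (d T : nat) (v0 : 'rV[R]_d) (x : nat -> 'rV[R]_d) (y sigma : nat -> R),
      (1 <= d)%N ->
      (3 <= T)%N ->
      unit_ball R d v0 ->
      (forall t : nat, (1 <= t <= T)%N -> unit_ball R d (x t)) ->
      (forall t : nat, (1 <= t <= T)%N -> feedback (y t) (dotv v0 (x t)) (sigma t)) ->
      (forall t : nat, (1 <= t <= T)%N ->
         steiner_pricing_guess T (knowledge_set x y sigma t) (x t) (y t)) ->
      \sum_(1 <= t < T.+1) pricing_loss (y t) (dotv v0 (x t))
        <= C * (d%:R * ln (ln T%:R) + d%:R * ln d%:R).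
Proof.
have l0 : 0 < ln (ln 3) :> R by rewrite ln_gt0// ln3_gt1.
have c0 : 0 < (145 + 64 * ln 32) / ln (ln 3) :> R.
  by rewrite divr_gt0// ltr_wpDr// mulr_ge0// ln_ge0// ler1n.
(* The quotient absorbs the constant terms, with [1 + 144 d <= 145 d]; 128 covers both
   [96 ln (ln T)] and [64 * 2 ln d]. *)
exists ((145 + 64 * ln 32) / ln (ln 3) + 128); first by rewrite addr_gt0.
move=> d T v0 x y sigma d0 T3 Bv0 Bx fb guess.
have dR : 1 <= d%:R :> R by rewrite ler1n.
have lnd0 := ln_ge0 dR.
have lT : ln (ln 3) <= ln (ln T%:R) :> R.
  have ln31 := ln3_gt1 R.
  have ln3T : ln 3 <= ln T%:R :> R.
    by rewrite ler_ln ?posrE ?ler_nat// ltr0n (leq_trans _ T3).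
  by rewrite ler_ln ?posrE//; lra.
apply: le_trans (total_pricing_loss d0 (ltnW T3) Bv0 Bx fb guess) _.
have h : 145 + 64 * ln 32 <= (145 + 64 * ln 32) / ln (ln 3) * ln (ln T%:R) :> R.
  by rewrite mulrAC ler_pdivlMr// ler_wpM2l// addr_ge0// mulr_ge0// ln_ge0// ler1n.
have h2 : d%:R * (145 + 64 * ln 32) <= d%:R * ((145 + 64 * ln 32) / ln (ln 3) * ln (ln T%:R)) :> R.
  by rewrite ler_wpM2l// (le_trans _ dR).
have h3 : 0 <= (145 + 64 * ln 32) / ln (ln 3) * (d%:R * ln d%:R) :> R.
  by rewrite mulr_ge0 ?(ltW c0)// mulr_ge0.
have h4 : 0 <= d%:R * ln (ln T%:R) :> R by rewrite mulr_ge0//; lra.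
rewrite mulrDl !mulrDr; nra.
Qed.
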